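(* Let $\mathsf{CMon}$ be the class of closeness classes of coarsely monotone maps and $\mathsf{CLight}$ the class of closeness classes of coarsely light maps in the coarse category. Then the pair $(\mathsf{CMon}, \mathsf{CLight})$ constitutes a factorization system on the coarse category. In particular, every ls-continuous map $f$ between ls-spaces factorizes as $f = f'e$ where $f'$ is coarsely light and $e$ is coarsely monotone.
   Context: For families $\mathcal{B},\mathcal{U}$ of subsets of a set $X$, $\mathrm{st}(B,\mathcal{U})$ is the union of the elements of $\mathcal{U}$ that intersect $B\subseteq X$, and $\mathrm{st}(\mathcal{B},\mathcal{U})=\{\mathrm{st}(B,\mathcal{U})\mid B\in\mathcal{B}\}$. A large scale structure (ls-structure) on $X$ is a nonempty set $\mathcal{L}$ of families of subsets of $X$ (the uniformly bounded families) such that (1) if $\mathcal{B}_1\in\mathcal{L}$ and each element of $\mathcal{B}_2$ with more than one point is contained in an element of $\mathcal{B}_1$, then $\mathcal{B}_2\in\mathcal{L}$; (2) $\mathcal{B}_1,\mathcal{B}_2\in\mathcal{L}$ implies $\mathrm{st}(\mathcal{B}_1,\mathcal{B}_2)\in\mathcal{L}$. An ls-space is a set with an ls-structure. A map $f:X\to Y$ of ls-spaces is ls-continuous if $f(\mathcal{U})=\{f(U)\mid U\in\mathcal{U}\}$ is uniformly bounded for every uniformly bounded $\mathcal{U}$. Maps $f,g:X\to Y$ are close ($f\sim g$) if $\{\{f(x),g(x)\}\mid x\in X\}$ is uniformly bounded. An ls-continuous map $f:X\to Y$ is a coarse equivalence if there is an ls-continuous $f':Y\to X$ with $ff'$ and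 $f'f$ close to the identities. The coarse category has ls-spaces as objects and closeness classes of ls-continuous maps as morphisms (its isomorphisms are the classes of coarse equivalences). For a family $\mathcal{U}$ of subsets of $X$ and $A\subseteq X$, the $\mathcal{U}$-components of $A$ are the equivalence classes of the relation on $A$: $x,x'$ are joined by a finite sequence $x=x_1,\dots,x_k=x'$ in $A$ such that each pair $x_i,x_{i+1}$ lies in a common element of $\mathcal{U}$. For ls-continuous $f:X\to Y$ and uniformly bounded families $\mathcal{U}$ in $X$ and $\mathcal{V}$ in $Y$, $c(\mathcal{U},f,\mathcal{V})$ is the family of all $\mathcal{U}$-components of sets $f^{-1}(V)$, $V\in\mathcal{V}$. The light structure on $X$ with respect to $f$ is the closure under refinement of the set of all $c(\mathcal{U},f,\mathcal{V})$ (that is, all families each of whose elements with more than one point is contained in an element of one fixed $c(\mathcal{U},f,\mathcal{V})$); it is an ls-structure containing that of $X$. $X_f$ denotes the set $X$ with this structure, and the light-part of $f$ is $f':X_f\to Y$, equal to $f$ as a set map. The map $f$ is coarsely light if the light structure with respect to $f$ equals the ls-structure of $X$; $f$ is coarsely monotone if $f':X_f\to Y$ is a coarse equivalence. Both properties are invariant under closeness. A pair $(\mathcal{E},\mathcal{M})$ of classes of morphisms of a category $\mathbb{C}$ is a factorization system if: (1) each of $\mathcal{E}$, $\mathcal{M}$ contains the isomorphisms and is closed under composition; (2) every morphism $f$ can be written $f=me$ with $m\in\mathcal{M}$, $e\in\mathcal{E}$; (3) whenever $e,e'\in\mathcal{E}$, $m,m'\in\mathcal{M}$ and $u,v$ are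 morphisms with $v m e = m' e' u$, there is a unique morphism $h$ with $he=e'u$ and $m'h=vm$. *)

(* Defs.v *)
From mathcomp Require Import all_boot.
From mathcomp Require Import boolp classical_sets.

Set Implicit Arguments.
Unset Strict Implicit.
Unset Printing Implicit Defensive.

Local Open Scope classical_set_scope.

Definition family (X : Type) := set (set X).

Definition star {X : Type} (B : set X) (U : family X) : set X :=
  \bigcup_(C in [set C | U C /\ B `&` C !=set0]) C.

Definition star_family {X : Type} (Bs U : family X) : family X :=
  [set star B U | B in Bs].

(** Members of [B2] with at most one point are unconstrained. *)
Definition refines {X : Type} (B2 B1 : family X) : Prop :=
  forall B, B2 B -> (exists x y, [/\ B x, B y & x <> y]) ->
  exists2 C, B1 C & B `<=` C.

Definition image_family {X Y : Type} (f : X -> Y) (U : family X) : family Y :=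
  [set f @` A | A in U].

Record is_ls_structure (X : Type) (L : set (family X)) : Prop := {
  ls_nonempty : L !=set0;
  ls_refine : forall B1 B2, L B1 -> refines B2 B1 -> L B2;
  ls_star : forall B1 B2, L B1 -> L B2 -> L (star_family B1 B2)
}.

Record ls_space : Type := LsSpace {
  carrier :> Type;
  unif_bounded : set (family carrier);
  unif_boundedP : is_ls_structure unif_bounded
}.

Definition ls_continuous (X Y : ls_space) (f : X -> Y) : Prop :=
  forall U, unif_bounded U -> unif_bounded (image_family f U).

Record ls_map (X Y : ls_space) : Type := LsMap {
  ls_fun :> X -> Y;
  ls_funP : ls_continuous ls_fun
}.

Definition close {X Y : ls_space} (f g : X -> Y) : Prop :=
  unif_bounded (range (fun x => [set f x; g x])).

Section UniformlyBounded.
Context {X : ls_space}.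

Lemma ub_sub (B1 B2 : family X) : unif_bounded B1 ->
  (forall B, B2 B -> exists2 C, B1 C & B `<=` C) -> unif_bounded B2.
Proof.
move=> h1 h; apply: (ls_refine (unif_boundedP X) h1) => B hB _; exact: h.
Qed.

Definition add_singletons (B : family X) : family X := B `|` range (fun x => [set x]).

Lemma ub_add_singletons (B : family X) : unif_bounded B -> unif_bounded (add_singletons B).
Proof.
move=> h; apply: (ls_refine (unif_boundedP X) h) => C [hC _|]; first by exists C.
by move=> [x _ <-] [a [b [-> ->]]].
Qed.

Lemma ub_union (B1 B2 : family X) :
  unif_bounded B1 -> unif_bounded B2 -> unif_bounded (B1 `|` B2).
Proof.
move=> h1 h2; have h := ls_star (unif_boundedP X)
  (ub_add_singletons h1) (ub_add_singletons h2).
apply: (ls_refine (unif_boundedP X) h) => C hC [x [_ [Cx _ _]]].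
case: hC => hC.
- exists (star C (add_singletons B2)); first by exists C => //; left.
  move=> z Cz; exists [set z] => //; split; first by right; exists z.
  by exists z.
- exists (star [set x] (add_singletons B2)); first by exists [set x] => //; right; exists x.
  by move=> z Cz; exists C => //; split; [left|exists x].
Qed.

Lemma ub_singletons : unif_bounded (range (fun x : X => [set x])).
Proof.
have [B hB] := ls_nonempty (unif_boundedP X).
by apply: (ub_sub (ub_add_singletons hB)) => C hC; exists C => //; right.
Qed.

End UniformlyBounded.

Section Closeness.
Context {X Y : ls_space}.

Lemma close_refl (f : X -> Y) : close f f.
Proof.
apply: (ub_sub ub_singletons) => _ [x _ <-]; exists [set f x]; first by exists (f x).
by move=> z [->|->].
Qed.

Lemma close_sym (f g : X -> Y) : close f g -> close g f.
Proof.
move=> h; apply: (ub_sub h) => _ [x _ <-]; exists [set f x; g x]; first by exists x.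
by move=> z [->|->]; [right|left].
Qed.

Lemma close_trans (f g h : X -> Y) : close f g -> close g h -> close f h.
Proof.
move=> h1 h2; have hs := ls_star (unif_boundedP Y) h1 (ub_union h1 h2).
apply: (ub_sub hs) => _ [x _ <-].
exists (star [set f x; g x] (range (fun x => [set f x; g x]) `|`
  range (fun x => [set g x; h x]))).
  by exists [set f x; g x] => //; exists x.
move=> z [->|->].
- exists [set f x; g x]; last by left.
  by split; [left; exists x|exists (f x); split; left].
- exists [set g x; h x]; last by right.
  by split; [right; exists x|exists (g x); split; [right|left]].
Qed.

End Closeness.

Lemma close_comp {X Y Z : ls_space} (f f' : ls_map X Y) (g g' : ls_map Y Z) :
  close f f' -> close g g' -> close (g \o f) (g' \o f').
Proof.
move=> h1 h2; apply: (@close_trans _ _ _ (g \o f')).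
- apply: (ub_sub (ls_funP g h1)) => _ [x _ <-].
  exists (g @` [set f x; f' x]); first by exists [set f x; f' x] => //; exists x.
  by move=> z [->|->]; [exists (f x)|exists (f' x)] => //; [left|right].
- by apply: (ub_sub h2) => _ [x _ <-]; exists [set g (f' x); g' (f' x)] => //; exists (f' x).
Qed.

Lemma ls_id_subproof (X : ls_space) : ls_continuous (@idfun X).
Proof.
move=> U hU; apply: (ub_sub hU) => _ [A hA <-]; exists A => //.
by move=> _ [x Ax <-].
Qed.

Definition ls_id (X : ls_space) : ls_map X X := LsMap (@ls_id_subproof X).

Lemma ls_comp_subproof (X Y Z : ls_space) (g : ls_map Y Z) (f : ls_map X Y) :
  ls_continuous (g \o f).
Proof.
move=> U hU; apply: (ub_sub (ls_funP g (ls_funP f hU))) => _ [A hA <-].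
exists (g @` (f @` A)); first by exists (f @` A) => //; exists A.
by move=> _ [x Ax <-]; exists (f x) => //; exists x.
Qed.

Definition ls_comp (X Y Z : ls_space) (g : ls_map Y Z) (f : ls_map X Y) :
  ls_map X Z := LsMap (@ls_comp_subproof X Y Z g f).

Definition coarse_equivalence (X Y : ls_space) (f : ls_map X Y) : Prop :=
  exists g : ls_map Y X,
    close (ls_comp f g) (ls_id Y) /\ close (ls_comp g f) (ls_id X).

Definition linked {X : Type} (U : family X) (A : set X) (x x' : X) : Prop :=
  exists (k : nat) (p : nat -> X),
    [/\ p 0 = x, p k = x', (forall i, i <= k -> A (p i)) &
        forall i, i < k -> exists2 W, U W & W (p i) /\ W (p i.+1)].

Definition components {X : Type} (U : family X) (A : set X) : family X :=
  [set [set x' | linked U A x x'] | x in A].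

Section Linked.
Context {X : Type}.
Implicit Types (U : family X) (A : set X).

Lemma linked_refl U A x : A x -> linked U A x x.
Proof. by move=> Ax; exists 0, (fun=> x). Qed.

Lemma linked_mono U U' A A' x y :
  U `<=` U' -> A `<=` A' -> linked U A x y -> linked U' A' x y.
Proof.
move=> hU hA [k [p [p0 pk pA pU]]]; exists k, p; split => // i hi.
- exact/hA/pA.
- by have [W /hU UW hW] := pU i hi; exists W.
Qed.

Lemma linked_sym U A x y : linked U A x y -> linked U A y x.
Proof.
move=> [k [p [p0 pk pA pU]]]; exists k, (fun i => p (k - i)); split.
- by rewrite subn0.
- by rewrite subnn.
- by move=> i _; apply: pA; apply: leq_subr.
- move=> i ik; have [|W UW [W1 W2]] := pU (k - i.+1).
    by rewrite -subn_gt0 subKn.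
  by exists W => //; split => //; rewrite subnSK in W2.
Qed.

Lemma linked_trans U A x y z : linked U A x y -> linked U A y z -> linked U A x z.
Proof.
move=> [k [p [p0 pk pA pU]]] [l [q [q0 ql qA qU]]].
exists (k + l), (fun i => if i <= k then p i else q (i - k)); split.
- by [].
- case: leqP => [|_]; last by rewrite addKn.
  rewrite -{2}[k]addn0 leq_add2l leqn0 => /eqP l0.
  by rewrite l0 addn0 pk -q0 -ql l0.
- move=> i hi; case: leqP => [/pA//|ki].
  by apply: qA; rewrite leq_subLR.
- move=> i hi; case: (ltngtP i k) => [ik|ki|ik].
  + exact: pU.
  + rewrite (subSn (ltnW ki)); apply: qU.
    by rewrite -(ltn_add2l k) (subnKC (ltnW ki)).
  + subst i; rewrite subSnn pk -q0; apply: qU.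
    by move: hi; rewrite -[X in X < _]addn0 ltn_add2l.
Qed.

End Linked.

(** [component_family U f V] is [c(U, f, V)]. *)
Definition component_family {X Y : Type} (U : family X) (f : X -> Y) (V : family Y) :
  family X := \bigcup_(A in V) components U (f @^-1` A).

Definition light_structure (X Y : ls_space) (f : ls_map X Y) : set (family X) :=
  [set B | exists U V, [/\ unif_bounded U, unif_bounded V &
                           refines B (component_family U f V)]].

Lemma component_family_cover (X Y : ls_space) (f : ls_map X Y)
    (U B : family X) (V : family Y) :
  refines B (component_family U f V) -> forall C x, B C -> C x ->
  exists2 A, add_singletons V A &
    C `<=` f @^-1` A /\ forall y z, C y -> C z -> linked U (f @^-1` A) y z.
Proof.
move=> hB C x BC Cx.
have [h|h] := pselect (exists x y, [/\ C x, C y & x <> y]).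
  have [D [A VA [a aA <-]] CD] := hB C BC h.
  exists A; first by left.
  have hl y : C y -> linked U (f @^-1` A) a y by move/CD.
  split=> [y /hl[k [p [_ <- pA _]]]|y z /hl hy /hl hz]; first exact: pA.
  exact: linked_trans (linked_sym hy) hz.
have Ceq y : C y -> y = x.
  by move=> Cy; apply: contrapT => yx; apply: h; exists y, x.
exists [set f x]; first by right; exists (f x).
split=> [y /Ceq->|y z /Ceq-> /Ceq->] //; exact: linked_refl.
Qed.

Lemma light_structureP (X Y : ls_space) (f : ls_map X Y) :
  is_ls_structure (light_structure f).
Proof.
split.
- have [U hU] := ls_nonempty (unif_boundedP X).
  have [V hV] := ls_nonempty (unif_boundedP Y).
  by exists (component_family U f V), U, V; split => // B hB _; exists B.
- move=> B1 B2 [U [V [hU hV h]]] h21; exists U, V; split => // B hB hB2.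
  have [C hC BC] := h21 B hB hB2.
  have [|D hD CD] := h C hC; last by exists D => //; apply: subset_trans CD.
  by case: hB2 => x [y [/BC Cx /BC Cy xy]]; exists x, y.
- move=> B1 B2 [U1 [V1 [hU1 hV1 h1]]] [U2 [V2 [hU2 hV2 h2]]].
  exists (U1 `|` U2), (star_family (add_singletons V1) (add_singletons V2)).
  split; first exact: ub_union.
    exact: (ls_star (unif_boundedP Y) (ub_add_singletons hV1) (ub_add_singletons hV2)).
  move=> _ [B hB <-] [c [_ [[C [hC [b [Bb Cb]]] Cc] _ _]]].
  have [A1 hA1 [BA1 lB]] := component_family_cover h1 hB Bb.
  set A := star A1 (add_singletons V2).
  have A1A : A1 `<=` A.
    by move=> y A1y; exists [set y] => //; split; [right; exists y|exists y].
  have key y : star B B2 y -> linked (U1 `|` U2) (f @^-1` A) b y.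
    move=> [D [hD [d [Bd Dd]]] Dy].
    have [A2 hA2 [DA2 lD]] := component_family_cover h2 hD Dd.
    apply: (linked_trans (y := d)).
      apply: linked_mono (lB b d Bb Bd) => [W hW|z]; [by left|exact: A1A].
    apply: linked_mono (lD d y Dd Dy) => [W hW|z hz]; first by right.
    by exists A2 => //; split => //; exists (f d); split; [exact: BA1|exact: DA2].
  exists [set y | linked (U1 `|` U2) (f @^-1` A) b y]; last exact: key.
  exists A; first by exists A1.
  by exists b => //; apply: A1A; exact: BA1.
Qed.

(** [X_f]: the carrier is definitionally that of [X]. *)
Definition light_space (X Y : ls_space) (f : ls_map X Y) : ls_space :=
  LsSpace (light_structureP f).

Lemma light_part_subproof (X Y : ls_space) (f : ls_map X Y) :
  @ls_continuous (light_space f) Y f.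
Proof.
move=> B [U [V [hU hV h]]].
apply: (ls_refine (unif_boundedP Y) (ub_add_singletons hV)) => _ [C hC <-] [_ [_ [[x Cx _] _ _]]].
have [A hA [CA _]] := component_family_cover h hC Cx.
by exists A => // _ [y /CA fy <-].
Qed.

Definition light_part (X Y : ls_space) (f : ls_map X Y) :
  ls_map (light_space f) Y := LsMap (@light_part_subproof X Y f).

Definition coarsely_light (X Y : ls_space) (f : ls_map X Y) : Prop :=
  light_structure f = @unif_bounded X.

Definition coarsely_monotone (X Y : ls_space) (f : ls_map X Y) : Prop :=
  coarse_equivalence (light_part f).

Record category : Type := Category {
  obj :> Type;
  hom : obj -> obj -> Type;
  cat_id : forall X, hom X X;
  cat_comp : forall X Y Z, hom Y Z -> hom X Y -> hom X Z;
  cat_comp_id_l : forall X Y (f : hom X Y), cat_comp (cat_id Y) f = f;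
  cat_comp_id_r : forall X Y (f : hom X Y), cat_comp f (cat_id X) = f;
  cat_compA : forall X Y Z W (h : hom Z W) (g : hom Y Z) (f : hom X Y),
    cat_comp h (cat_comp g f) = cat_comp (cat_comp h g) f
}.
Arguments cat_id {C} X : rename.
Arguments cat_comp {C X Y Z} g f : rename.
Arguments hom {C} X Y : rename.

Definition morphism_class (C : category) := forall X Y : C, hom X Y -> Prop.

Definition isomorphism {C : category} {X Y : C} (f : hom X Y) : Prop :=
  exists g : hom Y X, cat_comp g f = cat_id X /\ cat_comp f g = cat_id Y.

Definition contains_isomorphisms {C : category} (E : morphism_class C) : Prop :=
  forall (X Y : C) (f : hom X Y), isomorphism f -> E X Y f.

Definition closed_under_composition {C : category} (E : morphism_class C) : Prop :=
  forall (X Y Z : C) (g : hom Y Z) (f : hom X Y),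
    E Y Z g -> E X Y f -> E X Z (cat_comp g f).

Record factorization_system {C : category} (E M : morphism_class C) : Prop := {
  fs_isoE : contains_isomorphisms E;
  fs_isoM : contains_isomorphisms M;
  fs_compE : closed_under_composition E;
  fs_compM : closed_under_composition M;
  fs_factor : forall (X Y : C) (f : hom X Y),
    exists (Z : C) (e : hom X Z) (m : hom Z Y),
      [/\ E X Z e, M Z Y m & f = cat_comp m e];
  fs_diagonal : forall (A B D A' B' D' : C)
      (e : hom A B) (m : hom B D) (e' : hom A' B') (m' : hom B' D')
      (u : hom A A') (v : hom D D'),
    E A B e -> E A' B' e' -> M B D m -> M B' D' m' ->
    cat_comp v (cat_comp m e) = cat_comp m' (cat_comp e' u) ->
    exists! h : hom B B',
      cat_comp h e = cat_comp e' u /\ cat_comp m' h = cat_comp v m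
}.

(** A morphism of the coarse category is a closeness class, i.e. a set of
    ls-continuous maps, so that equality of morphisms is Leibniz equality. *)
Definition closeness_class {X Y : ls_space} (f : ls_map X Y) : set (ls_map X Y) :=
  [set g : ls_map X Y | close f g].

Definition coarse_hom (X Y : ls_space) : Type :=
  {F : set (ls_map X Y) | exists f, F = closeness_class f}.

Definition class_of {X Y : ls_space} (f : ls_map X Y) : coarse_hom X Y :=
  exist _ (closeness_class f) (ex_intro _ f erefl).

Lemma class_of_eqP (X Y : ls_space) (f g : ls_map X Y) :
  class_of f = class_of g <-> close f g.
Proof.
split=> [[/seteqP[_ fg]]|fg]; first by apply: fg; exact: close_refl.
apply: eq_exist => /=; apply/seteqP; split => h /= hh.
  by apply: close_trans hh; exact: close_sym.
exact: close_trans hh.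
Qed.

Lemma coarse_hom_ind (X Y : ls_space) (P : coarse_hom X Y -> Prop) :
  (forall f, P (class_of f)) -> forall F, P F.
Proof. by move=> h [F [f Ff]]; subst F; exact: h. Qed.

Definition comp_set {X Y Z : ls_space}
    (G : set (ls_map Y Z)) (F : set (ls_map X Y)) : set (ls_map X Z) :=
  [set h : ls_map X Z | exists g f, [/\ G g, F f & close (ls_comp g f) h]].

Lemma comp_set_class (X Y Z : ls_space) (g : ls_map Y Z) (f : ls_map X Y) :
  comp_set (closeness_class g) (closeness_class f) = closeness_class (ls_comp g f).
Proof.
apply/seteqP; split => h /=.
  by move=> [g' [f' [gg' ff' hh]]]; apply: close_trans hh; exact: close_comp.
by move=> hh; exists g, f; split => //; exact: close_refl.
Qed.

Lemma coarse_comp_subproof (X Y Z : ls_space)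
    (G : coarse_hom Y Z) (F : coarse_hom X Y) :
  exists f, comp_set (sval G) (sval F) = closeness_class f.
Proof.
elim/coarse_hom_ind: G => g; elim/coarse_hom_ind: F => f.
by exists (ls_comp g f); exact: comp_set_class.
Qed.

Definition coarse_comp (X Y Z : ls_space)
    (G : coarse_hom Y Z) (F : coarse_hom X Y) : coarse_hom X Z :=
  exist _ (comp_set (sval G) (sval F)) (coarse_comp_subproof G F).

Lemma coarse_compE (X Y Z : ls_space) (g : ls_map Y Z) (f : ls_map X Y) :
  coarse_comp (class_of g) (class_of f) = class_of (ls_comp g f).
Proof. by apply: eq_exist; exact: comp_set_class. Qed.

Definition coarse_id (X : ls_space) : coarse_hom X X := class_of (ls_id X).

Lemma coarse_comp_id_l (X Y : ls_space) (F : coarse_hom X Y) :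
  coarse_comp (coarse_id Y) F = F.
Proof.
elim/coarse_hom_ind: F => f; rewrite coarse_compE.
by apply/class_of_eqP; exact: close_refl.
Qed.

Lemma coarse_comp_id_r (X Y : ls_space) (F : coarse_hom X Y) :
  coarse_comp F (coarse_id X) = F.
Proof.
elim/coarse_hom_ind: F => f; rewrite coarse_compE.
by apply/class_of_eqP; exact: close_refl.
Qed.

Lemma coarse_compA (X Y Z W : ls_space)
    (H : coarse_hom Z W) (G : coarse_hom Y Z) (F : coarse_hom X Y) :
  coarse_comp H (coarse_comp G F) = coarse_comp (coarse_comp H G) F.
Proof.
elim/coarse_hom_ind: H => h; elim/coarse_hom_ind: G => g.
elim/coarse_hom_ind: F => f; rewrite !coarse_compE.
by apply/class_of_eqP; exact: close_refl.
Qed.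

Definition coarse_category : category :=
  Category coarse_comp_id_l coarse_comp_id_r coarse_compA.

Definition CMon : morphism_class coarse_category :=
  fun (X Y : ls_space) (F : coarse_hom X Y) =>
    exists f : ls_map X Y, coarsely_monotone f /\ F = class_of f.

Definition CLight : morphism_class coarse_category :=
  fun (X Y : ls_space) (F : coarse_hom X Y) =>
    exists f : ls_map X Y, coarsely_light f /\ F = class_of f.

(* Main.v *)
(** A chain in [X_f] over [A] refines to a chain in [X] over a star of [A], so
    passing to the light structure twice adds nothing: [id : X -> X_f] is
    monotone and [X_f -> Y] is light.  For the diagonal, let [e : A -> B] be
    monotone, with coarse inverse [s : B -> A_e].  If [m' k ~ w e] with [m']
    light, then [k] maps a component of [e^-1 V] to a chain whose [m']-image
    stays near [w V], so lightness of [m'] makes [k] ls-continuous on [A_e];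
    the diagonal is [k s], and it is unique because [e s ~ id]. *)
From mathcomp Require Import all_boot.
From mathcomp Require Import classical_sets.
Require Import Defs.

Set Implicit Arguments.
Unset Strict Implicit.
Unset Printing Implicit Defensive.

Local Open Scope classical_set_scope.

(** * Chains and components *)

Lemma linked_source (X : Type) (U : family X) (P : set X) x y :
  linked U P x y -> P x.
Proof. by move=> [k [p [<- _ pP _]]]; exact: pP. Qed.

Lemma linked_step (X : Type) (U : family X) (P W : set X) x y :
  U W -> W x -> W y -> P x -> P y -> linked U P x y.
Proof.
move=> UW Wx Wy Px Py; exists 1, (fun i => if i == 0 then x else y).
by split=> // [[|i]|[|i]] // _; exists W.
Qed.

(** A single step may become a whole chain in the target; this is what lets chains in a light space
    be unfolded into chains of the original space. *)
Lemma linked_map (X Y : Type) (f : X -> Y) (U : family X) (P : set X)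
    (U' : family Y) (P' : set Y) x y :
  (forall a, P a -> P' (f a)) ->
  (forall W a b, U W -> W a -> W b -> P a -> P b -> linked U' P' (f a) (f b)) ->
  linked U P x y -> linked U' P' (f x) (f y).
Proof.
move=> PP' step [k [p [<- <- pP pU]]].
suff H i : i <= k -> linked U' P' (f (p 0)) (f (p i)) by exact: H.
elim: i => [|i IH] ik; first by apply: linked_refl; apply/PP'/pP.
apply: linked_trans (IH (ltnW ik)) _.
have [W UW [Wi Wi1]] := pU i ik.
by apply: step UW Wi Wi1 _ _; apply: pP => //; exact: ltnW.
Qed.

(** Each initial segment of a chain is a chain from [x], so the chain never leaves the component of
    [x]. *)
Lemma linked_within_component (X : Type) (U : family X) (P : set X) x y :
  linked U P x y -> linked U [set z | linked U P x z] x y.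
Proof.
move=> [k [p [p0 pk pP pU]]]; exists k, p; split=> // i ik.
exists i, p; split=> // j jl; first by apply: pP; exact: leq_trans ik.
by apply: pU; exact: leq_trans ik.
Qed.

Lemma component_linked (X : Type) (U : family X) (P C : set X) x :
  C x -> (forall y z, C y -> C z -> linked U P y z) ->
  forall y z, C y -> C z -> linked U [set w | linked U P x w] y z.
Proof.
move=> Cx lC y z Cy Cz; apply: (linked_trans (y := x)).
  exact/linked_sym/linked_within_component/lC.
exact/linked_within_component/lC.
Qed.

(** * Uniform boundedness and closeness *)

Lemma ub_refine_inhabited (X : ls_space) (B1 B2 : family X) :
  unif_bounded B1 ->
  (forall B x, B2 B -> B x -> exists2 C, B1 C & B `<=` C) -> unif_bounded B2.
Proof.
move=> h1 h; apply: (ls_refine (unif_boundedP X) h1) => B hB [x [_ [Bx _ _]]].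
exact: h hB Bx.
Qed.

Lemma ub_star (X : ls_space) (B1 B2 : family X) :
  unif_bounded B1 -> unif_bounded B2 -> unif_bounded (star_family B1 B2).
Proof. exact: (ls_star (unif_boundedP X)). Qed.

Lemma close_postcomp (X Y Z : ls_space) (k : ls_map Y Z) (f g : X -> Y) :
  close f g -> close (k \o f) (k \o g).
Proof.
move=> fg; apply: (ub_sub (ls_funP k fg)) => _ [x _ <-].
exists (k @` [set f x; g x]); first by exists [set f x; g x] => //; exists x.
by move=> z [->|->]; [exists (f x)|exists (g x)] => //; [left|right].
Qed.

Lemma close_precomp (X Y Z : ls_space) (s : X -> Y) (f g : Y -> Z) :
  close f g -> close (f \o s) (g \o s).
Proof.
move=> fg; apply: (ub_sub fg) => _ [x _ <-].
by exists [set f (s x); g (s x)] => //; exists (s x).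
Qed.

(** * The light structure in terms of chains *)

Section LightStructure.
Context {X Y : ls_space} (f : ls_map X Y).

(** Working form of the light structure, without [refines] and [components]. One-point members are
    covered by adding singletons to [V]; the point [x] excludes empty members. *)
Lemma light_structure_linkedP (B : family X) :
  light_structure f B <->
  exists U V, [/\ unif_bounded U, unif_bounded V & forall C x, B C -> C x ->
    exists2 A, V A & forall y z, C y -> C z -> linked U (f @^-1` A) y z].
Proof.
split=> [[U [V [hU hV h]]]|[U [V [hU hV h]]]].
  exists U, (add_singletons V); split=> //; first exact: ub_add_singletons.
  move=> C x BC Cx; have [A hA [_ lA]] := component_family_cover h BC Cx.
  by exists A.
exists U, V; split=> // C BC [x [_ [Cx _ _]]].
have [A VA lA] := h C x BC Cx.
exists [set y | linked U (f @^-1` A) x y]; last by move=> y; exact: lA.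
by exists A => //; exists x => //; exact: linked_source (lA x x Cx Cx).
Qed.

Lemma ub_light_structure (B : family X) : unif_bounded B -> light_structure f B.
Proof.
move=> hB; apply/light_structure_linkedP; exists B, (image_family f B).
split=> //; first exact: ls_funP.
move=> C x BC Cx; exists (f @` C); first by exists C.
by move=> y z Cy Cz; apply: (linked_step BC) => //; [exists y|exists z].
Qed.

Lemma coarsely_lightP :
  coarsely_light f <-> forall B, light_structure f B -> unif_bounded B.
Proof.
split=> [lf B|h]; first by rewrite lf.
by apply/seteqP; split=> B; [exact: h|exact: ub_light_structure].
Qed.

Lemma to_light_space_subproof : @ls_continuous X (light_space f) idfun.
Proof.
move=> B hB; apply: ub_light_structure; apply: (ub_sub hB) => _ [C BC <-].
by exists C => // _ [x Cx <-].
Qed.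

Definition to_light_space : ls_map X (light_space f) :=
  LsMap to_light_space_subproof.

End LightStructure.

(** * The two factors of a map *)

Lemma coarsely_light_light_part (X Y : ls_space) (f : ls_map X Y) :
  coarsely_light (light_part f).
Proof.
apply/coarsely_lightP => B /light_structure_linkedP[U [V [hU hV hB]]].
have /light_structure_linkedP[U' [V' [hU' hV' hl]]] := hU.
apply/light_structure_linkedP.
(* A step of the chain unfolds to a chain over some member of [V'] that meets [A], hence over the
   star of [A]; the singletons keep [A] itself inside that star. *)
exists U', (star_family V (add_singletons V')); split=> //.
  by apply: ub_star => //; exact: ub_add_singletons.
move=> C x BC Cx; have [A VA lA] := hB C x BC Cx.
exists (star A (add_singletons V')); first by exists A.
move=> y z Cy Cz; apply: (linked_map (f := id)) (lA y z Cy Cz).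
  move=> a Aa; exists [set f a] => //; split; first by right; exists (f a).
  by exists (f a).
move=> W a b UW Wa Wb Aa Ab; have [A' VA' lA'] := hl W a UW Wa.
apply: linked_mono (lA' a b Wa Wb) => // c A'c.
exists A' => //; split; first by left.
by exists (f a); split=> //; exact: linked_source (lA' a b Wa Wb).
Qed.

Lemma coarsely_monotone_to_light_space (X Y : ls_space) (f : ls_map X Y) :
  coarsely_monotone (to_light_space f).
Proof.
have scont : @ls_continuous (light_space f) (light_space (to_light_space f)) idfun.
  move=> B /light_structure_linkedP[U [V [hU hV hB]]].
  (* The components are already uniformly bounded in [light_space f], and each is joined by chains
     that stay inside it. *)
  apply/light_structure_linkedP; exists U, (component_family U f V).
  split=> //; first by exists U, V; split=> // C hC _; exists C.
  move=> _ _ [C BC <-] [x Cx _]; have [A VA lA] := hB C x BC Cx.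
  exists [set y | linked U (f @^-1` A) x y].
    by exists A => //; exists x => //; exact: linked_source (lA x x Cx Cx).
  move=> _ _ [y Cy <-] [z Cz <-].
  exact: component_linked lA y z Cy Cz.
by exists (LsMap scont); split; exact: close_refl.
Qed.

(** * Coarse equivalences and composites *)

Lemma coarsely_light_coarse_equivalence (X Y : ls_space) (f : ls_map X Y) :
  coarse_equivalence f -> coarsely_light f.
Proof.
move=> [g [_ gf]]; apply/coarsely_lightP.
move=> B /light_structure_linkedP[U [V [hU hV hB]]].
(* Since [g (f y)] is near [y], the whole preimage of [A] lies in a star of the image of [A] under
   [g]. *)
apply: (ub_refine_inhabited (ub_star (ls_funP g hV) gf)) => C x BC Cx.
have [A VA lA] := hB C x BC Cx.
exists (star (g @` A) (range (fun x => [set ls_comp g f x; ls_id X x]))).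
  by exists (g @` A) => //; exists A.
move=> y Cy; exists [set g (f y); y]; last by right.
split; first by exists y.
exists (g (f y)); split; last by left.
by exists (f y) => //; exact: linked_source (lA y y Cy Cy).
Qed.

Lemma coarsely_monotone_coarse_equivalence (X Y : ls_space) (f : ls_map X Y) :
  coarse_equivalence f -> coarsely_monotone f.
Proof.
move=> [g [fg gf]]; exists (ls_comp (to_light_space f) g); split=> //.
exact: ub_light_structure.
Qed.

(** A chain over [A] maps under [f] into one component of the preimage of [A] under [g]. Lightness
    of [g] bounds these components in [Y], so they can serve as the control family for lightness of
    [f]. *)
Lemma coarsely_light_comp (X Y Z : ls_space) (g : ls_map Y Z) (f : ls_map X Y) :
  coarsely_light g -> coarsely_light f -> coarsely_light (ls_comp g f).
Proof.
move=> /coarsely_lightP lg /coarsely_lightP lf; apply/coarsely_lightP.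
move=> B /light_structure_linkedP[U [V [hU hV hB]]].
apply: lf; apply/light_structure_linkedP.
exists U, (component_family (image_family f U) g V); split=> //.
  apply: lg; exists (image_family f U), V; split=> //; first exact: ls_funP.
  by move=> C hC _; exists C.
move=> C x BC Cx; have [A VA lA] := hB C x BC Cx.
exists [set y | linked (image_family f U) (g @^-1` A) (f x) y].
  exists A => //; exists (f x) => //.
  exact: linked_source (lA x x Cx Cx).
move=> y z Cy Cz; apply: linked_mono (component_linked Cx lA Cy Cz) => // w.
apply: linked_map => // W a b UW Wa Wb Aa Ab.
by apply: (linked_step (W := f @` W)) => //; exists W.
Qed.

Lemma light_structure_comp (X Y Z : ls_space) (g : ls_map Y Z) (f : ls_map X Y) :
  light_structure f `<=` light_structure (ls_comp g f).
Proof.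
move=> B /light_structure_linkedP[U [V [hU hV hB]]].
apply/light_structure_linkedP; exists U, (image_family g V).
split=> //; first exact: ls_funP.
move=> C x BC Cx; have [A VA lA] := hB C x BC Cx.
exists (g @` A); first by exists A.
by move=> y z Cy Cz; apply: linked_mono (lA y z Cy Cz) => // a Aa; exists (f a).
Qed.

(** Lets [s] start from [light_space g], so that it can follow a coarse inverse of the light part of
    [g]. It turns each step of a chain in [Y] into a chain in [X], and [f s ~ id] controls where
    these lie over [Z]. *)
Lemma section_light_ls_continuous (X Y Z : ls_space) (g : ls_map Y Z)
    (f : ls_map X Y) (s : ls_map Y (light_space f)) :
  close (f \o s) idfun ->
  @ls_continuous (light_space g) (light_space (ls_comp g f)) s.
Proof.
move=> fs B /light_structure_linkedP[U [V [hU hV hB]]].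
have /light_structure_linkedP[U' [V' [hU' hV' hl]]] := ls_funP s hU.
pose N := range (fun y => [set (g \o (f \o s)) y; (g \o idfun) y]).
have hN : unif_bounded N := close_postcomp g fs.
apply/light_structure_linkedP.
(* The inner star absorbs the displacement between [g f s] and [g], the outer one the chains that
   replace single steps. *)
exists U', (star_family (star_family V N) (add_singletons (image_family g V'))).
split=> //; first apply: ub_star; first exact: ub_star.
  by apply: ub_add_singletons; exact: ls_funP.
move=> _ _ [C BC <-] [x Cx _]; have [A VA lA] := hB C x BC Cx.
have near b : A (g b) -> star A N (g (f (s b))).
  move=> Agb; exists [set g (f (s b)); g b]; last by left.
  by split; [exists b|exists (g b); split=> //; right].
exists (star (star A N) (add_singletons (image_family g V'))).
  by exists (star A N) => //; exists A.
move=> _ _ [y Cy <-] [z Cz <-]; apply: linked_map (lA y z Cy Cz).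
  move=> a /near h; exists [set g (f (s a))] => //.
  split; first by right; exists (g (f (s a))).
  by exists (g (f (s a))).
move=> W a b UW Wa Wb /near Aa _.
have [||A' VA' lA'] := hl (s @` W) (s a); [by exists W|by exists a|].
have lab : linked U' (f @^-1` A') (s a) (s b) by apply: lA'; [exists a|exists b].
apply: linked_mono lab => // c A'c; exists (g @` A'); last by exists (f c).
split; first by left; exists A'.
exists (g (f (s a))); split=> //; exists (f (s a)) => //.
have saW : (s @` W) (s a) by exists a.
exact: linked_source (lA' _ _ saW saW).
Qed.

Lemma coarsely_monotone_comp (X Y Z : ls_space) (g : ls_map Y Z) (f : ls_map X Y) :
  coarsely_monotone g -> coarsely_monotone f -> coarsely_monotone (ls_comp g f).
Proof.
move=> [t [gt tg]] [s [fs sf]].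
pose s' := LsMap (section_light_ls_continuous (g := g) fs).
exists (ls_comp s' t); split.
  apply: close_trans gt.
  (* Closeness sees the source only as a set, so [Y] may stand for [light_space g] here. *)
  exact: (close_precomp (Y := Y) t (close_postcomp g fs)).
apply: (@close_trans _ (light_space (ls_comp g f)) _ (s \o f)).
  exact: (close_precomp (Y := light_space g) f (close_postcomp s' tg)).
(* The closeness [s f ~ id] is known in [light_space f] and is carried to the larger structure of
   the composite. *)
exact: light_structure_comp sf.
Qed.

(** * Existence and uniqueness of the diagonal *)

Lemma light_extension_ls_continuous (A B C D : ls_space) (e : ls_map A B)
    (k : ls_map A C) (m : ls_map C D) (w : ls_map B D) :
  coarsely_light m -> close (w \o e) (m \o k) ->
  @ls_continuous (light_space e) C k.
Proof.
move=> /coarsely_lightP lm wemk Bs /light_structure_linkedP[U [V [hU hV hB]]].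
apply: lm; apply/light_structure_linkedP.
pose N := range (fun x => [set (w \o e) x; (m \o k) x]).
(* The star by [N] passes from [w e] to [m k]. *)
exists (image_family k U), (star_family (image_family w V) N).
split; [exact: ls_funP|by apply: ub_star => //; exact: ls_funP|].
move=> _ _ [S BS <-] [x Sx _]; have [P VP lP] := hB S x BS Sx.
exists (star (w @` P) N); first by exists (w @` P) => //; exists P.
have near a : P (e a) -> star (w @` P) N (m (k a)).
  move=> Pea; exists [set w (e a); m (k a)]; last by right.
  split; first by exists a.
  by exists (w (e a)); split; [exists (e a)|left].
move=> _ _ [y Sy <-] [z Sz <-]; apply: linked_map (lP y z Sy Sz).
  exact: near.
move=> W a b UW Wa Wb /near Pa /near Pb.
by apply: (linked_step (W := k @` W)) => //; exists W.
Qed.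

Lemma coarse_diagonal (A B C D : ls_space) (e : ls_map A B)
    (k : ls_map A C) (m : ls_map C D) (w : ls_map B D) :
  coarsely_monotone e -> coarsely_light m -> close (w \o e) (m \o k) ->
  exists h : ls_map B C, close (h \o e) k /\ close (m \o h) w.
Proof.
move=> [s [es se]] lm wemk.
pose k' := LsMap (light_extension_ls_continuous lm wemk).
exists (ls_comp k' s); split; first exact: (close_postcomp k' se).
apply: (@close_trans _ _ _ ((w \o e) \o s)).
  exact: (close_precomp (Y := A) s (close_sym wemk)).
exact: (close_postcomp w es).
Qed.

(** [h ~ h e s ~ h' e s ~ h']. The map [s] is ls-continuous only into [light_space e], which is
    enough: precomposition with any set map preserves closeness. *)
Lemma coarsely_monotone_epi (A B C : ls_space) (e : ls_map A B)
    (h h' : ls_map B C) :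
  coarsely_monotone e -> close (h \o e) (h' \o e) -> close h h'.
Proof.
move=> [s [es _]] hh'.
apply: close_trans (close_postcomp h' es).
apply: close_trans (close_precomp (Y := A) s hh').
exact/close_sym/(close_postcomp h es).
Qed.

(** * Passage to closeness classes *)

Lemma isomorphism_class_of (X Y : ls_space) (F : coarse_hom X Y) :
  @isomorphism coarse_category X Y F ->
  exists2 f : ls_map X Y, coarse_equivalence f & F = class_of f.
Proof.
elim/coarse_hom_ind: F => f [G]; elim/coarse_hom_ind: G => g.
rewrite /= !coarse_compE => -[/class_of_eqP gf /class_of_eqP fg].
by exists f => //; exists g.
Qed.

Lemma CMon_CLight_diagonal (A B D A' B' D' : coarse_category)
    (e : hom A B) (m : hom B D) (e' : hom A' B') (m' : hom B' D')
    (u : hom A A') (v : hom D D') :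
  CMon e -> CLight m' ->
  cat_comp v (cat_comp m e) = cat_comp m' (cat_comp e' u) ->
  exists! h : hom B B',
    cat_comp h e = cat_comp e' u /\ cat_comp m' h = cat_comp v m.
Proof.
move=> [e0 [he ->]] [m0' [hm' ->]].
elim/coarse_hom_ind: m => m; elim/coarse_hom_ind: e' => e'.
elim/coarse_hom_ind: u => u; elim/coarse_hom_ind: v => v.
rewrite /= !coarse_compE => /class_of_eqP sq.
(* The square is regrouped with [e0] and [m0'] on opposite sides, the other two sides being the
   composites [e' u] and [v m]. *)
have [h [hek mhw]] :=
  coarse_diagonal (k := ls_comp e' u) (w := ls_comp v m) he hm' sq.
exists (class_of h); split.
  by rewrite !coarse_compE; split; apply/class_of_eqP.
move=> H; elim/coarse_hom_ind: H => h'.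
rewrite !coarse_compE => -[/class_of_eqP h'ek _]; apply/class_of_eqP.
apply: (coarsely_monotone_epi he).
exact: close_trans hek (close_sym h'ek).
Qed.

Theorem theorem4p3 :
  factorization_system CMon CLight /\
  (forall (X Y : ls_space) (f : ls_map X Y),
     exists e : ls_map X (light_space f),
       [/\ coarsely_monotone e, coarsely_light (light_part f) &
           f =1 light_part f \o e]).
Proof.
split; last first.
  move=> X Y f; exists (to_light_space f); split=> //.
    exact: coarsely_monotone_to_light_space.
  exact: coarsely_light_light_part.
split.
- move=> X Y F /isomorphism_class_of[f hf ->]; exists f; split=> //.
  exact: coarsely_monotone_coarse_equivalence.
- move=> X Y F /isomorphism_class_of[f hf ->]; exists f; split=> //.
  exact: coarsely_light_coarse_equivalence.
- move=> X Y Z G F [g [hg ->]] [f [hf ->]]; exists (ls_comp g f).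
  by split; [exact: coarsely_monotone_comp|exact: coarse_compE].
- move=> X Y Z G F [g [hg ->]] [f [hf ->]]; exists (ls_comp g f).
  by split; [exact: coarsely_light_comp|exact: coarse_compE].
- move=> X Y F; elim/coarse_hom_ind: F => f.
  exists (light_space f), (class_of (to_light_space f)), (class_of (light_part f)).
  split.
  + exists (to_light_space f); split=> //.
    exact: coarsely_monotone_to_light_space.
  + by exists (light_part f); split=> //; exact: coarsely_light_light_part.
  + by rewrite /= coarse_compE; apply/class_of_eqP; exact: close_refl.
- move=> A B D A' B' D' e m e' m' u v Ee _ _ Mm'.
  exact: CMon_CLight_diagonal.
Qed.
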